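(* Let $A\in\mathbb{R}^{m\times n}$ and let $\mathbf{b}=[\underline b,\overline b]\subseteq\mathbb{R}^m$, $\mathbf{c}=[\underline c,\overline c]\subseteq\mathbb{R}^n$ be interval vectors. The type (C) interval linear program with degenerated matrix $\min\{\mathbf{c}^{\top}x : Ax\le\mathbf{b},\ x\ge 0\}$ has strongly zero duality gap if and only if at least one of the systems $$Ax\le\underline{b},\ x\ge 0\qquad\text{and}\qquad A^{\top}y\le\underline{c},\ y\le 0$$ is feasible.
   Context: For $\underline b\le\overline b$ (entrywise), $\mathbf{b}=[\underline b,\overline b]=\{b:\underline b\le b\le\overline b\}$, and similarly for $\mathbf{c}$. The interval linear program is the family of linear programs $\min\{c^{\top}x: Ax\le b,\ x\ge 0\}$ over all scenarios $(A,b,c)$ with $b\in\mathbf{b}$, $c\in\mathbf{c}$ and the fixed real matrix $A$ (''degenerated matrix''). The dual of the scenario $(A,b,c)$ is $\max\{b^{\top}y: A^{\top}y\le c,\ y\le 0\}$. A scenario has zero duality gap if and only if at least one of its primal and dual linear programs is feasible (otherwise the duality gap is $\infty$). The duality gap of the interval linear program is strongly zero if all scenarios have zero duality gap. *)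

(* Defs.v *)
From HB Require Import structures.
From mathcomp Require Import all_boot all_order all_algebra.
From mathcomp Require Import classical_sets reals ereal.
Set Implicit Arguments.
Unset Strict Implicit.
Unset Printing Implicit Defensive.
Import Order.TTheory GRing.Theory Num.Theory.
Local Open Scope classical_set_scope.
Local Open Scope ring_scope.

Definition vle (R : realType) (n : nat) (u v : 'cV[R]_n) : Prop :=
  forall i, u i 0 <= v i 0.

Definition ivec (R : realType) (n : nat) (lo hi : 'cV[R]_n) : set 'cV[R]_n :=
  [set v | vle lo v /\ vle v hi].

Definition dotv (R : realType) (n : nat) (u v : 'cV[R]_n) : R :=
  (u^T *m v) 0 0.

Definition primal_feasible (R : realType) (m n : nat)
    (A : 'M[R]_(m, n)) (b : 'cV[R]_m) : set 'cV[R]_n :=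
  [set x | vle (A *m x) b /\ vle 0 x].

Definition dual_feasible (R : realType) (m n : nat)
    (A : 'M[R]_(m, n)) (c : 'cV[R]_n) : set 'cV[R]_m :=
  [set y | vle (A^T *m y) c /\ vle y 0].

(* The optimal values live in the extended reals: an infeasible minimization
   has value +oo and an infeasible maximization has value -oo. *)
Definition primal_value (R : realType) (m n : nat)
    (A : 'M[R]_(m, n)) (b : 'cV[R]_m) (c : 'cV[R]_n) : \bar R :=
  ereal_inf [set (dotv c x)%:E | x in primal_feasible A b].

Definition dual_value (R : realType) (m n : nat)
    (A : 'M[R]_(m, n)) (b : 'cV[R]_m) (c : 'cV[R]_n) : \bar R :=
  ereal_sup [set (dotv b y)%:E | y in dual_feasible A c].

(* Equal infinite values (one program unbounded, the other one infeasible)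
   leave no gap; they are singled out because the library sets
   +oo - +oo = -oo.  If both programs are infeasible, the gap is
   +oo - -oo = +oo. *)
Definition duality_gap (R : realType) (m n : nat)
    (A : 'M[R]_(m, n)) (b : 'cV[R]_m) (c : 'cV[R]_n) : \bar R :=
  if primal_value A b c == dual_value A b c then 0%E
  else (primal_value A b c - dual_value A b c)%E.

Definition strongly_zero_gap (R : realType) (m n : nat) (A : 'M[R]_(m, n))
    (blo bhi : 'cV[R]_m) (clo chi : 'cV[R]_n) : Prop :=
  forall (b : 'cV[R]_m) (c : 'cV[R]_n),
    ivec blo bhi b -> ivec clo chi c -> duality_gap A b c = 0%E.

(* Main.v *)
Require Import Defs.
From HB Require Import structures.
From mathcomp Require Import all_boot all_order all_algebra.
From mathcomp Require Import classical_sets reals ereal.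
From mathcomp Require Import boolp.
From mathcomp Require Import ring lra.
Set Implicit Arguments.
Unset Strict Implicit.
Unset Printing Implicit Defensive.
Import Order.TTheory GRing.Theory Num.Theory.
Local Open Scope classical_set_scope.
Local Open Scope ring_scope.

(** The statement reduces to linear programming duality without any
    boundedness assumption: a single scenario has zero gap exactly when its
    primal or its dual is feasible.  Feasibility of the primal only becomes
    easier when [b] grows, and feasibility of the dual only becomes easier when
    [c] grows, so the scenario [(blo, clo)] is the worst one: if one of its
    two programs is feasible, the same program is feasible in every scenario,
    and if both are infeasible, its gap is infinite.

    Duality itself comes from Farkas' lemma.  The conic form [farkas_cone] is
    proved by induction on the number of inequalities, which needs no
    topology.  Homogenization turns it into the theorem of the alternative
    [farkas_nonneg] for [A x <= b], [x >= 0].  Applied to the system augmented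
    with the row [c^T x <= t], the alternative yields [dual_above]: if no
    primal solution has value at most [t], some dual solution has value above
    [t].  Together with weak duality this makes the two optimal values equal as
    extended reals, so the finite and the unbounded cases are settled at
    once. *)

(** * The entrywise order and the inner product *)

Section Vectors.
Variable R : realType.
Implicit Types (m n : nat).

Lemma vle_trans n (v u w : 'cV[R]_n) : vle u v -> vle v w -> vle u w.
Proof. by move=> uv vw i; apply: le_trans (uv i) (vw i). Qed.

Lemma vle_col_mx m n (u u' : 'cV[R]_m) (v v' : 'cV[R]_n) :
  vle (col_mx u v) (col_mx u' v') <-> vle u u' /\ vle v v'.
Proof.
split=> [h|[hu hv] i].
  split=> i; first by have := h (lshift n i); rewrite !col_mxEu.
  by have := h (rshift m i); rewrite !col_mxEd.
by rewrite -(splitK i); case: (split i) => j /=; rewrite ?col_mxEu ?col_mxEd.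
Qed.

Lemma vle_scalar (a b : R) : vle (a%:M : 'cV[R]_1) b%:M <-> a <= b.
Proof.
by split=> [/(_ 0)|h i]; rewrite ?ord1 !mxE !eqxx !mulr1n.
Qed.

Lemma dotvE n (u v : 'cV[R]_n) : dotv u v = \sum_i u i 0 * v i 0.
Proof. by rewrite /dotv mxE; apply: eq_bigr => i _; rewrite mxE. Qed.

Lemma dotvC n (u v : 'cV[R]_n) : dotv u v = dotv v u.
Proof. by rewrite !dotvE; apply: eq_bigr => i _; rewrite mulrC. Qed.

Lemma dotvDr n (u v w : 'cV[R]_n) : dotv u (v + w) = dotv u v + dotv u w.
Proof. by rewrite /dotv mulmxDr mxE. Qed.

Lemma dotvZr n a (u v : 'cV[R]_n) : dotv u (a *: v) = a * dotv u v.
Proof. by rewrite /dotv -scalemxAr mxE. Qed.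

Lemma dotvNr n (u v : 'cV[R]_n) : dotv u (- v) = - dotv u v.
Proof. by rewrite -scaleN1r dotvZr mulN1r. Qed.

Lemma dotv0r n (u : 'cV[R]_n) : dotv u 0 = 0.
Proof. by rewrite /dotv mulmx0 mxE. Qed.

Lemma dotv_col_mx m n (u u' : 'cV[R]_m) (v v' : 'cV[R]_n) :
  dotv (col_mx u v) (col_mx u' v') = dotv u u' + dotv v v'.
Proof. by rewrite /dotv tr_col_mx mul_row_col mxE. Qed.

Lemma dotv_scalar (a b : R) : dotv (a%:M : 'cV[R]_1) b%:M = a * b.
Proof. by rewrite /dotv tr_scalar_mx -scalar_mxM mxE eqxx mulr1n. Qed.

Lemma dotv_trmx m n (A : 'M[R]_(m, n)) (u : 'cV[R]_m) (x : 'cV[R]_n) :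
  dotv (A^T *m u) x = dotv u (A *m x).
Proof. by rewrite /dotv trmx_mul trmxK mulmxA. Qed.

Lemma trmx_mul_cV n (c x : 'cV[R]_n) : c^T *m x = (dotv c x)%:M.
Proof. by rewrite [LHS]mx11_scalar. Qed.

Lemma ler_dotv n (u v w : 'cV[R]_n) :
  vle 0 u -> vle v w -> dotv u v <= dotv u w.
Proof.
move=> u0 vw; rewrite !dotvE; apply: ler_sum => i _.
by apply: ler_wpM2l (vw i); have := u0 i; rewrite mxE.
Qed.

(** * Farkas' lemma *)

(** Bartl's argument: if the implication already follows from the
    inequalities other than [a], the multiplier of [a] is zero.  Otherwise
    some [x0] violates it while satisfying those inequalities, hence
    [dotv a x0 > 0], and projecting along [x0] onto the hyperplane
    [dotv a x = 0] eliminates [a] from the system.  Nothing topological, such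
    as the closedness of a finitely generated cone, is involved. *)
Lemma farkas_cone m n (A : 'M[R]_(m, n)) (c : 'cV[R]_n) :
  (forall x, vle (A *m x) 0 -> dotv c x <= 0) ->
  exists u : 'cV[R]_m, vle 0 u /\ c = A^T *m u.
Proof.
elim: m => [|m IH] in A c *.
  (* With no inequality, every [x] is admissible, in particular [x = c]. *)
  move=> /(_ c) h; exists 0; split=> //; rewrite mulmx0.
  have /h : vle (A *m c) 0 by move=> [].
  rewrite dotvE => c0; apply/colP=> i; rewrite mxE; apply/eqP.
  rewrite -sqrf_eq0; apply/eqP/le_anti; rewrite sqr_ge0 andbT.
  apply: le_trans c0; rewrite (bigD1 i) //= expr2 lerDl.
  by apply: sumr_ge0 => j _; rewrite -expr2 sqr_ge0.
rewrite -[m.+1]/(1 + m)%N in A *; rewrite -(vsubmxK A).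
set a := (usubmx A)^T; set B := dsubmx A.
have -> : usubmx A = a^T by rewrite trmxK.
have col0 : 0 = col_mx (0%:M : 'cV[R]_1) (0 : 'cV[R]_m).
  by rewrite raddf0 col_mx0.
move=> h.
have [hB|] := pselect (forall x, vle (B *m x) 0 -> dotv c x <= 0).
  have [u [u0 ->]] := IH _ _ hB; exists (col_mx 0%:M u); split.
    by rewrite col0; apply/vle_col_mx; rewrite vle_scalar.
  by rewrite tr_col_mx mul_row_col mul_mx_scalar scale0r add0r.
move=> /existsNP[x0 /not_implyP[Bx0 /negP]]; rewrite -ltNge => cx0.
have mulE x : col_mx a^T B *m x = col_mx (dotv a x)%:M (B *m x).
  by rewrite mul_col_mx trmx_mul_cV.
have ax0 : 0 < dotv a x0.
  rewrite ltNge; apply/negP=> ax0; move: cx0; rewrite ltNge => /negP; apply.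
  by apply: h; rewrite mulE col0; apply/vle_col_mx; rewrite vle_scalar.
set k := (dotv a x0)^-1.
have k0 : 0 < k by rewrite invr_gt0.
(* [B'] and [c'] are [B] and [c] precomposed with the projection
   [x |-> x - (k * dotv a x) *: x0]. *)
pose B' := B - (k *: (B *m x0)) *m a^T.
pose c' := c - (k * dotv c x0) *: a.
have [x hx|u [u0 cE]] := IH B' c'.
  pose x' := x - (k * dotv a x) *: x0.
  have ax' : dotv a x' = 0.
    rewrite dotvDr dotvNr dotvZr mulrAC [k * _]mulVf ?gt_eqF //.
    by rewrite mul1r subrr.
  have Bx' : B *m x' = B' *m x.
    rewrite mulmxBr mulmxBl -scalemxAr -[_ *m a^T *m x]mulmxA trmx_mul_cV.
    by rewrite mul_mx_scalar scalerA [k * _]mulrC.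
  have cx' : dotv c x' = dotv c' x.
    rewrite ![dotv c' x]dotvC !dotvDr !dotvNr !dotvZr ![dotv x _]dotvC.
    ring.
  rewrite -cx'; apply: h; rewrite mulE ax' Bx' col0.
  by apply/vle_col_mx; split.
have uB : dotv u (B *m x0) <= 0.
  by rewrite -(dotv0r u); apply: ler_dotv.
exists (col_mx (k * (dotv c x0 - dotv u (B *m x0)))%:M u); split.
  rewrite col0; apply/vle_col_mx; split=> //; apply/vle_scalar.
  by rewrite mulr_ge0 ?ltW // subr_gt0 (le_lt_trans uB).
rewrite tr_col_mx trmxK mul_row_col mul_mx_scalar.
rewrite -[LHS](subrK ((k * dotv c x0) *: a)) -/c' cE linearB /=.
rewrite trmx_mul trmxK linearZ /= mulmxBl -mulmxA -scalemxAl.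
rewrite trmx_mul_cV (dotvC _ u) -scalemxAr mul_mx_scalar scalerA.
by rewrite mulrBr scalerBl addrC addrAC addrA.
Qed.

(** Homogenization: the infeasibility of the system says that every solution
    [(x, t)] of [A x <= t b], [- x <= 0] has [t <= 0], since for [t > 0] the
    vector [x / t] would be feasible.  The multiplier of the rows [- x <= 0]
    is the slack [A^T u]. *)
Lemma farkas_nonneg m n (A : 'M[R]_(m, n)) (b : 'cV[R]_m) :
  ~ (exists x : 'cV[R]_n, vle (A *m x) b /\ vle 0 x) ->
  exists u : 'cV[R]_m, [/\ vle 0 u, vle 0 (A^T *m u) & dotv b u < 0].
Proof.
move=> infeasible.
pose M := block_mx A (- b) (- 1%:M : 'M_n) (0 : 'cV[R]_n).
have [z|u [u0]] := @farkas_cone _ _ M (col_mx 0 1%:M).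
  rewrite -[z]vsubmxK; set x := usubmx z; set t := dsubmx z.
  rewrite (mx11_scalar t); move: (t 0 0) => {}t.
  rewrite mul_block_col -[0 : 'cV_(m + n)]col_mx0 => /vle_col_mx[Axt x0].
  rewrite dotv_col_mx dotv_scalar dotvC dotv0r add0r mul1r leNgt.
  apply/negP=> t0; apply: infeasible; exists (t^-1 *: x); split=> i.
    have := Axt i; rewrite mul_mx_scalar -scalemxAr !mxE mulrN subr_le0.
    by rewrite ler_pdivrMl.
  have := x0 i; rewrite mul0mx addr0 mulNmx mul1mx !mxE oppr_le0 => xi.
  by rewrite mulr_ge0 // invr_ge0 ltW.
move: u0; rewrite -[u]vsubmxK; move: (usubmx u) (dsubmx u) => {}u v.
rewrite -[0 : 'cV_(m + n)]col_mx0 => /vle_col_mx[u0 v0].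
rewrite /M tr_block_mx mul_block_col => /eq_col_mx[].
rewrite !linearN /= trmx1 mulNmx mul1mx => /esym/subr0_eq Au.
rewrite trmx0 mul0mx addr0 mulNmx trmx_mul_cV => /matrixP/(_ 0 0).
rewrite !mxE eqxx !mulr1n => bu.
by exists u; split; rewrite ?Au //; move: bu; lra.
Qed.

End Vectors.

(** * Linear programming duality *)

Section Duality.
Variables (R : realType) (m n : nat) (A : 'M[R]_(m, n)).
Implicit Types (b : 'cV[R]_m) (c : 'cV[R]_n).

Lemma weak_duality b c x y :
  primal_feasible A b x -> dual_feasible A c y -> dotv b y <= dotv c x.
Proof.
move=> [Axb x0] [Ayc y0].
have Ny0 : vle 0 (- y) by move=> i; have := y0 i; rewrite !mxE oppr_ge0.
have := ler_dotv Ny0 Axb; have := ler_dotv x0 Ayc.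
rewrite ![dotv (- y) _]dotvC !dotvNr lerN2 [dotv x _]dotvC dotv_trmx.
rewrite [dotv x c]dotvC [dotv (A *m x) y]dotvC.
by move=> h1 h2; apply: le_trans h2 h1.
Qed.

(** The alternative provides multipliers [u] of [A x <= b] and [s] of
    [c^T x <= t].  If [s > 0], then [- u / s] is the required dual solution.
    If [s = 0], then [u] certifies that the primal is infeasible, so a dual
    solution exists, and its value increases without bound along the
    direction [- u]. *)
Lemma dual_above b c t :
  primal_feasible A b !=set0 \/ dual_feasible A c !=set0 ->
  (forall x, primal_feasible A b x -> t < dotv c x) ->
  exists2 y, dual_feasible A c y & t < dotv b y.
Proof.
move=> feas above.
have [[x [Mx x0]]|z] := @farkas_nonneg _ _ _ (col_mx A c^T) (col_mx b t%:M).
  move: Mx; rewrite mul_col_mx trmx_mul_cV => /vle_col_mx[Axb].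
  by rewrite vle_scalar leNgt above.
rewrite -[z]vsubmxK; move: (usubmx z) (dsubmx z) => u s'.
rewrite (mx11_scalar s'); move: (s' 0 0) => {z s'} s.
rewrite tr_col_mx trmxK mul_row_col mul_mx_scalar dotv_col_mx dotv_scalar.
rewrite -{1}col_mx0 => -[/vle_col_mx[u0]].
move=> /(_ 0); rewrite !mxE eqxx mulr1n => s0 Auc bus.
move: s0; rewrite le_eqVlt => /orP[/eqP s0|s_gt0]; last first.
  exists (- s^-1 *: u); last first.
    rewrite dotvZr mulNr ltrNr mulrC ltr_pdivrMr //.
    by move: bus; lra.
  split=> i.
    have := Auc i; rewrite -scalemxAr !mxE => h.
    rewrite mulNr lerNl ler_pdivlMl //; lra.
  have := u0 i; rewrite !mxE mulNr oppr_le0 => h.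
  by rewrite mulr_ge0 ?invr_ge0 // ltW.
subst s; rewrite mulr0 addr0 in bus; rewrite scale0r addr0 in Auc.
case: feas => [[x [Axb x0]]|[y [Ayc y0]]].
  exfalso; move: (ler_dotv u0 Axb) (ler_dotv x0 Auc).
  rewrite -dotv_trmx dotv0r [dotv x _]dotvC [dotv u b]dotvC; lra.
(* The step length that raises the value from [dotv b y] to at least
   [t + 1]; the absolute value keeps the step nonnegative. *)
pose k := (`|t - dotv b y| + 1) / - dotv b u.
have k0 : 0 <= k by rewrite divr_ge0 ?addr_ge0 // oppr_ge0 ltW.
exists (y - k *: u); last first.
  rewrite dotvDr dotvNr dotvZr.
  have -> : k * dotv b u = - (`|t - dotv b y| + 1).
    by rewrite /k invrN mulrN mulNr mulfVK // lt_eqF.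
  by have := ler_norm (t - dotv b y); lra.
split=> i.
  rewrite mulmxBr -scalemxAr; have := Ayc i; have := Auc i.
  rewrite !mxE => h h'.
  by apply: le_trans h'; rewrite lerBlDr lerDl mulr_ge0.
have := y0 i; have := u0 i; rewrite !mxE => h h'.
by rewrite subr_le0; apply: le_trans h' _; rewrite mulr_ge0.
Qed.

(** The equality is one of extended reals, hence it also covers the case of
    one infeasible program, where the other one is unbounded.  By
    [dual_above], every real below the primal value is strictly below the dual
    value; a dual value smaller than the primal value would contradict this at
    the dual value itself or, if that is [-oo], at any real below the primal
    value. *)
Lemma strong_duality b c :
  primal_feasible A b !=set0 \/ dual_feasible A c !=set0 ->
  primal_value A b c = dual_value A b c.
Proof.
move=> feas; apply/le_anti/andP; split; last first.
  apply: ge_ereal_sup => _ [y hy <-]; apply: le_ereal_inf_tmp => _ [x hx <-].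
  by rewrite lee_fin; apply: weak_duality hx hy.
have ge_dual t : (t%:E < primal_value A b c -> t%:E < dual_value A b c)%E.
  move=> tP; have [x hx|y hy ty] := @dual_above b c t feas.
    by rewrite -lte_fin (lt_le_trans tP) //; apply: ereal_inf_lbound; exists x.
  have /lt_le_trans : (t%:E < (dotv b y)%:E)%E by rewrite lte_fin.
  by apply; apply: ereal_sup_ubound; exists y.
rewrite leNgt; apply/negP.
move: (dual_value A b c) (primal_value A b c) ge_dual => [d||] [p||] // above.
- by move=> /above; rewrite ltxx.
- by move=> /above; rewrite ltxx.
- by have /above : ((p - 1)%:E < p%:E)%E by rewrite lte_fin gtrBl.
- by have /above := ltry (0 : R).
Qed.

Lemma infeasible_gap b c :
  ~ (primal_feasible A b !=set0) -> ~ (dual_feasible A c !=set0) ->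
  duality_gap A b c = +oo%E.
Proof.
move=> /set0P/negP/negPn/eqP P0 /set0P/negP/negPn/eqP D0.
by rewrite /duality_gap /primal_value /dual_value P0 D0 !image_set0
  ereal_inf0 ereal_sup0.
Qed.

End Duality.

Theorem corollary8 (R : realType) (m n : nat) (A : 'M[R]_(m, n))
    (blo bhi : 'cV[R]_m) (clo chi : 'cV[R]_n)
    (hb : vle blo bhi) (hc : vle clo chi) :
  strongly_zero_gap A blo bhi clo chi <->
  ((exists x : 'cV[R]_n, vle (A *m x) blo /\ vle 0 x) \/
   (exists y : 'cV[R]_m, vle (A^T *m y) clo /\ vle y 0)).
Proof.
split=> [zero|feas b c [blo_b _] [clo_c _]].
  apply: contrapT => /not_orP[P0 D0].
  have : duality_gap A blo clo = 0%E by apply: zero; split.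
  by rewrite infeasible_gap.
rewrite /duality_gap strong_duality ?eqxx //.
case: feas => [[x [Ax x0]]|[y [Ay y0]]].
  by left; exists x; split=> //; apply: vle_trans Ax blo_b.
by right; exists y; split=> //; apply: vle_trans Ay clo_c.
Qed.
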